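(* Let $\alpha,\beta\in\mathbb{R}$, $\eta\in\{1,-1\}$, and let $G_4$ be the connected, simply connected three-dimensional Lie group with left-invariant Lorentzian metric $g$ whose Lie algebra has a pseudo-orthonormal basis $\{\widetilde e_1,\widetilde e_2,\widetilde e_3\}$, with $\widetilde e_3$ timelike, satisfying $$[\widetilde e_1,\widetilde e_2]=-\widetilde e_2+(2\eta-\beta)\widetilde e_3,\quad [\widetilde e_1,\widetilde e_3]=-\beta\widetilde e_2+\widetilde e_3,\quad [\widetilde e_2,\widetilde e_3]=\alpha\widetilde e_1.$$ Then the symmetrized Ricci tensor $\widetilde\rho^c$ of the canonical connection $\nabla^c$ is a Codazzi tensor on $(G_4,\nabla^c)$ if and only if $\frac{\alpha}{2}+\eta-\beta=0$.
   Context: Basis vectors are identified with left-invariant vector fields on the group $G$; $g(\widetilde e_1,\widetilde e_1)=g(\widetilde e_2,\widetilde e_2)=1$, $g(\widetilde e_3,\widetilde e_3)=-1$, and $g(\widetilde e_i,\widetilde e_j)=0$ for $i\ne j$. Let $\nabla^L$ be the Levi-Civita connection of $g$ and $J$ the product structure on $G$ (a $(1,1)$ tensor field) with $J\widetilde e_1=\widetilde e_1$, $J\widetilde e_2=\widetilde e_2$, $J\widetilde e_3=-\widetilde e_3$. The canonical connection is $\nabla^c_XY=\nabla^L_XY-\tfrac12(\nabla^L_XJ)JY$, where $(\nabla^L_XJ)Y=\nabla^L_X(JY)-J\nabla^L_XY$. Curvature: $R^c(X,Y)Z=\nabla^c_X\nabla^c_YZ-\nabla^c_Y\nabla^c_XZ-\nabla^c_{[X,Y]}Z$.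 Ricci tensor: $\rho^c(X,Y)=-g(R^c(X,\widetilde e_1)Y,\widetilde e_1)-g(R^c(X,\widetilde e_2)Y,\widetilde e_2)+g(R^c(X,\widetilde e_3)Y,\widetilde e_3)$. Symmetrized Ricci tensor: $\widetilde\rho^c(X,Y)=\tfrac12(\rho^c(X,Y)+\rho^c(Y,X))$. For a linear connection $\nabla$ and a $(0,2)$ tensor field $\omega$: $(\nabla_X\omega)(Y,Z)=X[\omega(Y,Z)]-\omega(\nabla_XY,Z)-\omega(Y,\nabla_XZ)$. The tensor $\omega$ is called a Codazzi tensor on $(G,\nabla)$ if $(\nabla_X\omega)(Y,Z)-(\nabla_Y\omega)(X,Z)=0$ for all vector fields $X,Y,Z$. *)

(* Defs.v *)
From HB Require Import structures.
From mathcomp Require Import all_boot all_order all_algebra.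
From mathcomp Require Import all_classical all_reals all_analysis.
Import Order.TTheory GRing.Theory Num.Theory.
Import numFieldNormedType.Exports.

Set Implicit Arguments.
Unset Strict Implicit.
Unset Printing Implicit Defensive.

Local Open Scope classical_set_scope.
Local Open Scope ring_scope.
Section SmoothMaps.
Context {R : realType}.
(* For V finite-dimensional and U open, this is the usual class C^k: f is
   differentiable on U and all its directional derivatives are C^(k-1). *)
Fixpoint Ck {V W : normedModType R} (k : nat) (U : set V) (f : V -> W) : Prop :=
  if k is k'.+1 then
    (forall x, U x -> differentiable f x) /\ (forall v, Ck k' U ('D_v f))
  else forall x, U x -> {for x, continuous f}.

Definition smooth_on {V W : normedModType R} (U : set V) (f : V -> W) : Prop :=
  forall k, Ck k U f.

Context {V : normedModType R}.
Implicit Types (U : set V).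

Lemma near_eq_differentiable {W : normedModType R} (f g : V -> W) (x : V) :
  (\near x, f x = g x) -> differentiable f x -> differentiable g x.
Proof.
move=> fg df.
have -> : g = f + (g - f) by rewrite addrC subrK.
apply: differentiableD => //.
set e := g - f.
have e0 : \near x, e x = 0.
  by near=> y; rewrite /e !fctE (near fg y) // subrr.
apply/diffP.
apply: (@getPex _ (fun (df : {linear V -> W}) => continuous df /\
  forall y, e y = e (lim (nbhs x)) + df (y - lim (nbhs x))
                  +o_(y \near x) (y - lim (nbhs x)))).
exists (\0 : {linear V -> W}); split => [y|]; first exact: cvg_cst.
apply: eqaddoEx => y; rewrite lim_id// (nbhs_singleton e0) !add0r.
suff -> : e = [o_x (center x) of e] by [].
apply/eqoP => _/posnumP[eps]; near=> z.
by rewrite (near e0 z) // normr0.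
Unshelve. all: by end_near. Qed.

Lemma Ck_eq {W : normedModType R} k U (f g : V -> W) : open U ->
  (forall x, U x -> f x = g x) -> Ck k U f -> Ck k U g.
Proof.
move=> oU; elim: k f g => [|k IH] f g fg /=.
  move=> fc x Ux; have nfg : \near x, f x = g x.
    by apply: filterS (open_nbhs_nbhs (conj oU Ux)).
  have fgx : f @ x --> g x by rewrite -fg//; exact: fc.
  exact: cvg_trans (near_eq_cvg nfg) fgx.
have nfg x : U x -> \near x, f x = g x.
  by move=> Ux; apply: filterS (open_nbhs_nbhs (conj oU Ux)).
move=> [df Df]; split=> [x Ux|v].
  by apply: near_eq_differentiable (nfg x Ux) (df x Ux).
by apply: IH (Df v) => x Ux; apply: near_eq_derive; exact: nfg.
Qed.

Lemma Ck_continuous {W : normedModType R} k U (f : V -> W) x :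
  Ck k U f -> U x -> {for x, continuous f}.
Proof.
by case: k => [|k] /= => [fc /fc//|[df _] /df /differentiable_continuous].
Qed.

Lemma CkS {W : normedModType R} k U (f : V -> W) : Ck k.+1 U f -> Ck k U f.
Proof.
elim: k f => [|k IH] f [df Df]; first by move=> x /df /differentiable_continuous.
by split=> // v; exact: IH (Df v).
Qed.

Lemma Ck_cst {W : normedModType R} k U (a : W) : Ck k U (cst a).
Proof.
elim: k a => [|k IH] a /=; first by move=> x _; exact: cvg_cst.
split=> [x _|v]; first exact: differentiable_cst.
have -> : 'D_v (cst a) = cst 0 by apply/funext => x; rewrite derive_cst.
exact: IH.
Qed.

Lemma CkD {W : normedModType R} k U (f g : V -> W) : open U ->
  Ck k U f -> Ck k U g -> Ck k U (f + g).
Proof.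
move=> oU; elim: k f g => [|k IH] f g /=.
  by move=> fc gc x Ux; apply: cvgD; [exact: fc | exact: gc].
move=> [df Df] [dg Dg]; split=> [x Ux|v].
  by apply: differentiableD; [exact: df | exact: dg].
apply: (@Ck_eq _ _ _ ('D_v f + 'D_v g)) => //; last exact: IH.
by move=> x Ux; rewrite deriveD//; apply: diff_derivable; [exact: df|exact: dg].
Qed.

Lemma CkN {W : normedModType R} k U (f : V -> W) : open U ->
  Ck k U f -> Ck k U (- f).
Proof.
move=> oU; elim: k f => [|k IH] f /=.
  by move=> fc x Ux; apply: cvgN; exact: fc.
move=> [df Df]; split=> [x Ux|v]; first by apply: differentiableN; exact: df.
apply: (@Ck_eq _ _ _ (- 'D_v f)) => //; last exact: IH.
by move=> x Ux; rewrite deriveN//; apply: diff_derivable; exact: df.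
Qed.

Lemma CkM k U (f g : V -> R) : open U -> Ck k U f -> Ck k U g -> Ck k U (f * g).
Proof.
move=> oU; elim: k f g => [|k IH] f g.
  by move=> /= fc gc x Ux; apply: cvgM; [exact: fc | exact: gc].
move=> Cf Cg; have [df Df] := Cf; have [dg Dg] := Cg; split=> [x Ux|v].
  by apply: differentiableM; [exact: df | exact: dg].
apply: (@Ck_eq _ _ _ (f * 'D_v g + g * 'D_v f)) => //.
  move=> x Ux; have := df x Ux; have := dg x Ux.
  move=> /(@diff_derivable _ _ _ _ _ v) dgx /(@diff_derivable _ _ _ _ _ v) dfx.
  by rewrite deriveM.
by apply: CkD => //; apply: IH; [exact: CkS Cf|exact: Dg|exact: CkS Cg|exact: Df].
Qed.

Lemma derive_line {W : normedModType R} (f : V -> W) (x u : V) (s : R) :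
  derivable f (x + s *: u) u ->
  is_derive s 1 (fun s => f (x + s *: u)) ('D_u f (x + s *: u)).
Proof.
have E : (fun h : R => h^-1 *: (((fun s => f (x + s *: u)) \o shift s) (h *: (1:R)) - f (x + s *: u)))
       = (fun h : R => h^-1 *: ((f \o shift (x + s *: u)) (h *: u) - f (x + s *: u))).
  apply/funext => h /=; congr (_ *: (f _ - _)).
  by rewrite scalerDl [h *: 1]mulr1 addrCA.
by move=> df; apply: DeriveDef; rewrite /derivable /derive E.
Qed.

Lemma MVT2 U (f : V -> R) (x u v : V) (h : R) : 0 < h ->
  (forall s t, s \in `[0, h]%R -> t \in `[0, h]%R -> U (x + s *: u + t *: v)) ->
  Ck 2 U f ->
  exists s t, [/\ s \in `[0, h]%R, t \in `[0, h]%R &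
   f (x + h *: u + h *: v) - f (x + h *: u) - f (x + h *: v) + f x
   = 'D_v ('D_u f) (x + s *: u + t *: v) * h * h].
Proof.
move=> h0 Uh [df Df].
have zin : (0 : R) \in `[0, h]%R by rewrite in_itv /= lexx ltW.
have hin : h \in `[0, h]%R by rewrite in_itv /= lexx ltW.
pose F s := f (x + h *: v + s *: u) - f (x + s *: u).
pose dF s := 'D_u f (x + h *: v + s *: u) - 'D_u f (x + s *: u).
have Fd s : s \in `[0, h]%R -> is_derive s 1 F (dF s).
  move=> sh.
  have d1 : derivable f (x + h *: v + s *: u) u.
    by apply: diff_derivable; apply: df; rewrite addrAC; exact: Uh.
  have d2 : derivable f (x + s *: u) u.
    apply: diff_derivable; apply: df.
    by have := Uh _ _ sh zin; rewrite scale0r addr0.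
  exact: is_deriveB (derive_line d1) (derive_line d2).
have Fc : {within `[0, h], continuous F}.
  apply: derivable_within_continuous => s sh; by case: (Fd s sh).
have Fo s : s \in `]0, h[%R -> is_derive s 1 F (dF s).
  by move=> /subset_itv_oo_cc; exact: Fd.
have [s sh Es] := MVT_segment (ltW h0) Fo Fc.
pose K t := 'D_u f (x + s *: u + t *: v).
pose dK t := 'D_v ('D_u f) (x + s *: u + t *: v).
have Kd t : t \in `[0, h]%R -> is_derive t 1 K (dK t).
  move=> th.
  have d : derivable ('D_u f) (x + s *: u + t *: v) v.
    by apply: diff_derivable; have [d _] := Df u; apply: d; exact: Uh.
  exact: derive_line d.
have Kc : {within `[0, h], continuous K}.
  apply: derivable_within_continuous => t th; by case: (Kd t th).
have Ko t : t \in `]0, h[%R -> is_derive t 1 K (dK t).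
  by move=> /subset_itv_oo_cc; exact: Kd.
have [t th Et] := MVT_segment (ltW h0) Ko Kc.
exists s, t; split => //.
rewrite subr0 in Et; rewrite subr0 in Es.
rewrite -Et.
have -> : K h - K 0 = dF s by rewrite /K /dF scale0r addr0 addrAC.
rewrite -Es /F !scale0r !addr0 opprB (addrAC x (h *: v)) addrA.
by rewrite -!addrA; congr (_ + (_ + _)); rewrite addrC.
Qed.

Lemma derive_sym U (f : V -> R) (x u v : V) : open U -> U x -> Ck 2 U f ->
  'D_v ('D_u f) x = 'D_u ('D_v f) x.
Proof.
move=> oU Ux Cf.
have [_ Df] := Cf.
have cA : {for x, continuous ('D_v ('D_u f))} by have [_ D] := Df u; exact: D v x Ux.
have cB : {for x, continuous ('D_u ('D_v f))} by have [_ D] := Df v; exact: D u x Ux.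
apply/eqP; rewrite -subr_eq0 -normr_eq0 eq_le normr_ge0 andbT.
apply/ler_addgt0Pl => e e0; rewrite addr0.
have e2 : 0 < e / 2 by rewrite divr_gt0.
have /cvgrPdist_lt/(_ _ e2)/nbhs_normP[dA /= dA0 HA] := cA.
have /cvgrPdist_lt/(_ _ e2)/nbhs_normP[dB /= dB0 HB] := cB.
have /nbhs_normP[dU /= dU0 HU] := open_nbhs_nbhs (conj oU Ux).
pose d := Num.min dU (Num.min dA dB).
have d0 : 0 < d by rewrite !lt_min dU0 dA0 dB0.
pose h := d / (1 + `|u| + `|v|).
have M0 : 0 < 1 + `|u| + `|v| by rewrite -addrA ltr_pwDl.
have h0 : 0 < h by rewrite divr_gt0.
have near_x s t : s \in `[0, h]%R -> t \in `[0, h]%R ->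
    `|x - (x + s *: u + t *: v)| < d.
  rewrite !in_itv /= => /andP[s0 sh] /andP[t0 th].
  rewrite -addrA opprD addrA subrr add0r normrN.
  apply: (le_lt_trans (ler_normD _ _)); rewrite !normrZ !ger0_norm//.
  apply: (@le_lt_trans _ _ (h * (`|u| + `|v|))).
    by rewrite mulrDr lerD// ler_wpM2r.
  rewrite /h mulrAC ltr_pdivrMr// ltr_pM2l//.
  by rewrite -[ltRHS]addrA ltrDr.
have Uh s t : s \in `[0, h]%R -> t \in `[0, h]%R -> U (x + s *: u + t *: v).
  move=> sh th; apply: HU => /=; apply: (lt_le_trans (near_x _ _ sh th)).
  by rewrite !ge_min lexx.
have Uh' s t : s \in `[0, h]%R -> t \in `[0, h]%R -> U (x + s *: v + t *: u).
  by move=> sh th; rewrite addrAC; exact: Uh.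
have [s [t [sh th E1]]] := MVT2 h0 Uh Cf.
have [t' [s' [th' sh' E2]]] := MVT2 h0 Uh' Cf.
have E : 'D_v ('D_u f) (x + s *: u + t *: v) =
         'D_u ('D_v f) (x + s' *: u + t' *: v).
  apply: (mulIf (lt0r_neq0 h0)); apply: (mulIf (lt0r_neq0 h0)).
  rewrite -E1 (addrAC x (s' *: u)) -E2 (addrAC x (h *: v)) (addrAC _ (- f _) (- f _)).
  by [].
have lA : `|'D_v ('D_u f) x - 'D_v ('D_u f) (x + s *: u + t *: v)| < e / 2.
  apply: HA => /=; apply: (lt_le_trans (near_x _ _ sh th)).
  by rewrite !ge_min lexx orbT.
have lB : `|'D_u ('D_v f) x - 'D_u ('D_v f) (x + s' *: u + t' *: v)| < e / 2.
  apply: HB => /=; apply: (lt_le_trans (near_x _ _ sh' th')).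
  by rewrite !ge_min lexx !orbT.
rewrite E in lA; rewrite distrC in lB.
rewrite [e]splitr; apply: le_trans (ltW (ltrD lA lB)).
by apply: le_trans (ler_normD _ _); rewrite addrA subrK.
Qed.
End SmoothMaps.

Record chart (R : realType) (n : nat) (T : topologicalType) := Chart {
  chart_dom : set T;
  chart_img : set 'rV[R]_n;
  chart_map :> T -> 'rV[R]_n;
  chart_inv : 'rV[R]_n -> T;
  chart_dom_open : open chart_dom;
  chart_img_open : open chart_img;
  chart_mapP : forall p, chart_dom p -> chart_img (chart_map p);
  chart_invP : forall x, chart_img x -> chart_dom (chart_inv x);
  chart_mapK : forall p, chart_dom p -> chart_inv (chart_map p) = p;
  chart_invK : forall x, chart_img x -> chart_map (chart_inv x) = x;
  chart_map_continuous :
    forall p, chart_dom p -> {for p, continuous chart_map};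
  chart_inv_continuous :
    forall x, chart_img x -> {for x, continuous chart_inv} }.

(* A smooth structure is given by one smooth atlas, not required to be
   maximal. *)
HB.mixin Record isLieGroup (R : realType) (n : nat) G
    of Topological G & Group G := {
  atlas : set (chart R n G);
  atlas_cover : forall p : G, exists2 phi, atlas phi & chart_dom phi p;
  atlas_compatible : forall phi psi, atlas phi -> atlas psi ->
    smooth_on [set x | chart_img phi x /\ chart_dom psi (chart_inv phi x)]
      (fun x => psi (chart_inv phi x));
  lie_hausdorff : hausdorff_space G;
  lie_second_countable : @second_countable G;
  lie_mul_continuous : continuous (fun p : G * G => (p.1 * p.2)%g);
  lie_mul_smooth : forall phi psi chi, atlas phi -> atlas psi -> atlas chi ->
    smooth_on
      [set x : 'rV[R]_n * 'rV[R]_n |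
        [/\ chart_img phi x.1, chart_img psi x.2 &
            chart_dom chi (chart_inv phi x.1 * chart_inv psi x.2)%g]]
      (fun x : 'rV[R]_n * 'rV[R]_n =>
         chi (chart_inv phi x.1 * chart_inv psi x.2)%g);
  lie_inv_continuous : continuous (fun p : G => (p^-1)%g);
  lie_inv_smooth : forall phi psi, atlas phi -> atlas psi ->
    smooth_on [set x | chart_img phi x /\ chart_dom psi (chart_inv phi x)^-1%g]
      (fun x => psi (chart_inv phi x)^-1%g) }.

#[short(type="lieGroupType")]
HB.structure Definition LieGroup (R : realType) (n : nat) :=
  { G of Topological G & Group G & isLieGroup R n G }.

(* Path-connected, and every loop is null-homotopic relative to its base
   point. *)
Definition simply_connected (R : realType) (T : topologicalType) : Prop :=
  [/\ [set: T] !=set0,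
   forall p q : T, exists gamma : R -> T,
     [/\ {within `[0, 1], continuous gamma}, gamma 0 = p & gamma 1 = q] &
   forall gamma : R -> T, {within `[0, 1], continuous gamma} ->
     gamma 0 = gamma 1 ->
     exists H : R * R -> T,
       [/\ {within `[0, 1] `*` `[0, 1], continuous H},
           forall t : R, 0 <= t <= 1 -> H (0, t) = gamma t,
           forall t : R, 0 <= t <= 1 -> H (1, t) = gamma 0 &
           forall s : R, 0 <= s <= 1 ->
             H (s, 0) = gamma 0 /\ H (s, 1) = gamma 0]].

Section SmoothFunctions.
Context {R : realType} {n : nat} (G : lieGroupType R n).

Definition is_smooth (f : G -> R) : Prop :=
  forall phi : chart R n G, atlas phi ->
    smooth_on (chart_img phi) (fun x => f (chart_inv phi x)).

Definition smooth_pred : {pred G -> R} := fun f => `[< is_smooth f >].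

Lemma smooth_subring_closed : subring_closed smooth_pred.
Proof.
split=> [|f g|f g].
- by apply/asboolP => phi _ k; exact: Ck_cst.
- move=> /asboolP sf /asboolP sg; apply/asboolP => phi aphi k.
  by apply: CkD; [exact: chart_img_open|exact: sf|
    apply: CkN; [exact: chart_img_open|exact: sg]].
- move=> /asboolP sf /asboolP sg; apply/asboolP => phi aphi k.
  by apply: CkM; [exact: chart_img_open|exact: sf|exact: sg].
Qed.
HB.instance Definition _ :=
  GRing.isSubringClosed.Build (G -> R) smooth_pred smooth_subring_closed.

Record smoothfun := SmoothFun {
  smoothfun_val :> G -> R;
  smoothfunP : smoothfun_val \in smooth_pred }.

HB.instance Definition _ := [isSub for smoothfun_val].
HB.instance Definition _ := [Choice of smoothfun by <:].
HB.instance Definition _ :=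
  GRing.SubChoice_isSubComPzRing.Build _ _ smoothfun smooth_subring_closed.

Lemma is_smooth_cst (a : R) : is_smooth (cst a).
Proof. by move=> phi _ k; exact: Ck_cst. Qed.
Definition smooth_cst (a : R) : smoothfun :=
  SmoothFun (asboolT (is_smooth_cst a)).

End SmoothFunctions.

Section VectorFields.
Context {R : realType} {n : nat} (G : lieGroupType R n).
Local Notation Cinf := (smoothfun G).

Definition pd (i : 'I_n) (F : 'rV[R]_n -> R) : 'rV[R]_n -> R :=
  'D_(delta_mx 0 i) F.

(* A smooth vector field is identified with its action on smooth functions; in
   each chart it is a combination of the coordinate derivations with smooth
   coefficients. *)
Definition is_vector_field (X : Cinf -> Cinf) : Prop :=
  forall phi : chart R n G, atlas phi ->
    exists2 a : 'I_n -> 'rV[R]_n -> R,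
      forall i, smooth_on (chart_img phi) (a i) &
      forall (f : Cinf) x, chart_img phi x ->
        X f (chart_inv phi x)
        = \sum_(i < n) a i x * pd i (fun y => f (chart_inv phi y)) x.

Record vector_field := VectorField {
  vector_field_op :> Cinf -> Cinf;
  vector_fieldP : is_vector_field vector_field_op }.

HB.instance Definition _ := gen_eqMixin vector_field.
HB.instance Definition _ := gen_choiceMixin vector_field.

Lemma smoothfun_eq (f g : Cinf) : (forall p, f p = g p) -> f = g.
Proof. by move=> fg; apply: val_inj; apply/funext. Qed.

Lemma vector_field_eq (X Y : vector_field) : (forall f, X f = Y f) -> X = Y.
Proof.
case: X Y => [X hX] [Y hY] /= XY.
have {}XY : X = Y by apply/funext.
by case: _ / XY hY => hY; congr VectorField; exact: Prop_irrelevance.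
Qed.

Lemma smoothfun_chart (f : Cinf) (phi : chart R n G) : atlas phi ->
  smooth_on (chart_img phi) (fun y => f (chart_inv phi y)).
Proof. by move=> aphi; have /asboolP := smoothfunP f; apply. Qed.

Lemma is_vector_field0 : is_vector_field (fun=> 0).
Proof.
move=> phi _; exists (fun _ => cst 0) => [i k|f x _]; first exact: Ck_cst.
by rewrite big1// => i _; rewrite mul0r.
Qed.

Lemma is_vector_fieldD (X Y : vector_field) :
  is_vector_field (fun f => X f + Y f).
Proof.
move=> phi aphi.
have [a sa aE] := vector_fieldP X aphi; have [b sb bE] := vector_fieldP Y aphi.
exists (fun i => a i + b i) => [i k|f x Ux].
  exact: CkD (@chart_img_open _ _ _ phi) (sa i k) (sb i k).
rewrite [LHS](congr2 +%R (aE f x Ux) (bE f x Ux)) -big_split /=.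
by apply: eq_bigr => i _; rewrite mulrDl.
Qed.

Lemma is_vector_fieldZ (h : Cinf) (X : vector_field) :
  is_vector_field (fun f => h * X f).
Proof.
move=> phi aphi; have [a sa aE] := vector_fieldP X aphi.
exists (fun i => (fun y => h (chart_inv phi y)) * a i) => [i k|f x Ux].
  exact: CkM (@chart_img_open _ _ _ phi) (smoothfun_chart h aphi k) (sa i k).
rewrite [LHS](congr1 ( *%R (h (chart_inv phi x))) (aE f x Ux)) mulr_sumr.
by apply: eq_bigr => i _; rewrite mulrA.
Qed.

Lemma is_vector_fieldN (X : vector_field) : is_vector_field (fun f => - X f).
Proof.
have := is_vector_fieldZ (-1) X.
by congr is_vector_field; apply/funext => f; rewrite mulN1r.
Qed.

Let zero := VectorField is_vector_field0.
Let opp X := VectorField (is_vector_fieldN X).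
Let add X Y := VectorField (is_vector_fieldD X Y).
Let scale h X := VectorField (is_vector_fieldZ h X).

Let addA : associative add.
Proof. by move=> X Y Z; apply: vector_field_eq => f /=; rewrite addrA. Qed.
Let addC : commutative add.
Proof. by move=> X Y; apply: vector_field_eq => f /=; rewrite addrC. Qed.
Let add0 : left_id zero add.
Proof. by move=> X; apply: vector_field_eq => f /=; rewrite add0r. Qed.
Let addN : left_inverse zero opp add.
Proof. by move=> X; apply: vector_field_eq => f /=; rewrite addNr. Qed.
HB.instance Definition _ :=
  GRing.isZmodule.Build vector_field addA addC add0 addN.

Let scaleA h k X : scale h (scale k X) = scale (h * k) X.
Proof. by apply: vector_field_eq => f /=; rewrite mulrA. Qed.
Let scale1 : left_id 1 scale.
Proof. by move=> X; apply: vector_field_eq => f /=; rewrite mul1r. Qed.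
Let scaleDr : right_distributive scale +%R.
Proof. by move=> h X Y; apply: vector_field_eq => f /=; rewrite mulrDr. Qed.
Let scaleDl X : {morph scale^~ X : h k / h + k}.
Proof. by move=> h k; apply: vector_field_eq => f /=; rewrite mulrDl. Qed.
HB.instance Definition _ := GRing.Zmodule_isLmodule.Build Cinf vector_field
  scaleA scale1 scaleDr scaleDl.

Lemma pd_smooth U (i : 'I_n) (F : 'rV[R]_n -> R) :
  smooth_on U F -> smooth_on U (pd i F).
Proof. by move=> sF k; have [_ D] := sF k.+1; exact: D. Qed.

Lemma pd_sumM U (F : 'I_n -> 'rV[R]_n -> R) (H : 'I_n -> 'rV[R]_n -> R) i x :
  U x -> (forall j, smooth_on U (F j)) -> (forall j, smooth_on U (H j)) ->
  pd i (fun y => \sum_j F j y * H j y) x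
  = \sum_j (F j x * pd i (H j) x + pd i (F j) x * H j x).
Proof.
move=> Ux sF sH.
have dF j : derivable (F j) x (delta_mx 0 i).
  by apply: diff_derivable; have [d _] := sF j 1%N; exact: d.
have dH j : derivable (H j) x (delta_mx 0 i).
  by apply: diff_derivable; have [d _] := sH j 1%N; exact: d.
have -> : (fun y => \sum_j F j y * H j y) = \sum_(j < n) (F j * H j).
  by apply/funext => y; rewrite fct_sumE.
rewrite /pd derive_sum; last by move=> j; exact: derivableM.
by apply: eq_bigr => j _; rewrite deriveM// [X in _ + X = _]mulrC.
Qed.

Lemma smooth_sum U m (F : 'I_m -> 'rV[R]_n -> R) : open U ->
  (forall j, smooth_on U (F j)) -> smooth_on U (\sum_j F j).
Proof.
move=> oU sF k; elim/big_ind : _ => [|f g|j _]; [|exact: CkD|exact: sF].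
exact: Ck_cst.
Qed.

Lemma is_vector_field_bracket (X Y : vector_field) :
  is_vector_field (fun f => X (Y f) - Y (X f)).
Proof.
move=> phi aphi; have oU := @chart_img_open _ _ _ phi.
have [a sa aE] := vector_fieldP X aphi; have [b sb bE] := vector_fieldP Y aphi.
pose c i := \sum_(j < n) (a j * pd j (b i) - b j * pd j (a i)).
exists c => [i|f x Ux].
  apply: smooth_sum => // j k; apply: CkD => //.
    by apply: CkM => //; [exact: sa|exact: pd_smooth].
  by apply: CkN => //; apply: CkM => //; [exact: sb|exact: pd_smooth].
set F := fun y => f (chart_inv phi y).
have sF : smooth_on (chart_img phi) F := smoothfun_chart f aphi.
have nearE (Z : vector_field) (z : 'I_n -> 'rV[R]_n -> R) i :
    (forall (f : Cinf) x, chart_img phi x -> Z f (chart_inv phi x)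
      = \sum_(i < n) z i x * pd i (fun y => f (chart_inv phi y)) x) ->
    (forall i, smooth_on (chart_img phi) (z i)) ->
    pd i (fun y => Z f (chart_inv phi y)) x
    = \sum_j (z j x * pd i (pd j F) x + pd i (z j) x * pd j F x).
  move=> zE sz; rewrite -(@pd_sumM (chart_img phi))//; last first.
    by move=> j; exact: pd_smooth.
  apply: near_eq_derive; apply: filterS (open_nbhs_nbhs (conj oU Ux)) => y Uy.
  exact: zE.
have -> : (X (Y f) - Y (X f)) (chart_inv phi x)
    = X (Y f) (chart_inv phi x) - Y (X f) (chart_inv phi x) by [].
rewrite aE// bE//.
under eq_bigr do rewrite (nearE Y b)//.
under [X in _ - X]eq_bigr do rewrite (nearE X a)//.
under [RHS]eq_bigr do rewrite /c fct_sumE mulr_suml.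
rewrite [RHS]exchange_big /=.
have split2 (y z : 'I_n -> 'rV[R]_n -> R) :
    \sum_i y i x * \sum_j (z j x * pd i (pd j F) x + pd i (z j) x * pd j F x)
    = \sum_i \sum_j y i x * z j x * pd i (pd j F) x
      + \sum_i \sum_j y i x * pd i (z j) x * pd j F x.
  rewrite -big_split; apply: eq_bigr => i _ /=.
  rewrite mulr_sumr -big_split; apply: eq_bigr => j _ /=.
  by rewrite mulrDr !mulrA.
rewrite !split2.
have -> : \sum_i \sum_j b i x * a j x * pd i (pd j F) x
        = \sum_i \sum_j a i x * b j x * pd i (pd j F) x.
  rewrite exchange_big; apply: eq_bigr => i _; apply: eq_bigr => j _ /=.
  by rewrite (mulrC (b j x)) /pd (derive_sym _ _ oU Ux (sF 2%N)).
rewrite opprD addrACA subrr add0r -sumrB; apply: eq_bigr => i _.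
by rewrite -sumrB; apply: eq_bigr => j _; rewrite -mulrBl.
Qed.

Definition lie_bracket (X Y : vector_field) : vector_field :=
  VectorField (is_vector_field_bracket X Y).

End VectorFields.

Arguments smooth_cst {R n G} a.

Section LeftInvariance.
Context {R : realType} {n : nat} {G : lieGroupType R n}.
Local Notation VF := (vector_field G).

(* Y is the push-forward of X under left translation by a; the smooth function
   h is f \o L_a. *)
Definition left_related (a : G) (X Y : VF) : Prop :=
  forall f h : smoothfun G, (forall p, h p = f (a * p)%g) ->
    forall p, X h p = Y f (a * p)%g.

Definition left_invariant (X : VF) : Prop := forall a : G, left_related a X X.

Definition lie_algebra_basis3 (e1 e2 e3 : VF) : Prop :=
  [/\ left_invariant e1, left_invariant e2, left_invariant e3 &
   forall X : VF, left_invariant X ->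
     exists! c : R * R * R,
       X = smooth_cst c.1.1 *: e1 + smooth_cst c.1.2 *: e2
           + smooth_cst c.2 *: e3].

End LeftInvariance.

Section Geometry.
Context {R : realType} {n : nat} {G : lieGroupType R n}.
Local Notation VF := (vector_field G).
Local Notation Cinf := (smoothfun G).
Implicit Types (omega g : VF -> VF -> Cinf) (nabla : VF -> VF -> VF).

Definition is_tensor02 omega : Prop :=
  (forall (f : Cinf) (X Y Z : VF),
     omega (f *: X + Y) Z = f * omega X Z + omega Y Z) /\
  (forall (f : Cinf) (X Y Z : VF),
     omega X (f *: Y + Z) = f * omega X Y + omega X Z).

(* The last clause says that g has signature (+, ..., +, -) at every point: the
   E i span the tangent space at p, and their Gram matrix is
   diag(1, ..., 1, -1). *)
Definition is_lorentzian_metric g : Prop :=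
  [/\ is_tensor02 g,
      forall X Y : VF, g X Y = g Y X &
      forall p : G, exists E : 'I_n -> VF,
        (forall X : VF, exists c : 'I_n -> R,
           forall f : Cinf, X f p = \sum_(i < n) c i * E i f p) /\
        (forall i j : 'I_n,
           g (E i) (E j) p
           = if i != j then 0 else if i.+1 == n then -1 else 1)].

Definition left_invariant_metric g : Prop :=
  forall (a : G) (X Y X' Y' : VF), left_related a X X' -> left_related a Y Y' ->
    forall p, g X Y p = g X' Y' (a * p)%g.

Definition pseudo_orthonormal3 g (e1 e2 e3 : VF) : Prop :=
  [/\ g e1 e1 = 1, g e2 e2 = 1 & g e3 e3 = -1] /\
  [/\ g e1 e2 = 0, g e1 e3 = 0, g e2 e3 = 0,
      g e2 e1 = 0 & g e3 e1 = 0 /\ g e3 e2 = 0].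

Definition is_connection nabla : Prop :=
  [/\ forall (f : Cinf) (X Y Z : VF),
        nabla (f *: X + Y) Z = f *: nabla X Z + nabla Y Z,
      forall X Y Z : VF, nabla X (Y + Z) = nabla X Y + nabla X Z &
      forall (f : Cinf) (X Y : VF),
        nabla X (f *: Y) = X f *: Y + f *: nabla X Y].

Definition cov_deriv02 nabla omega (X Y Z : VF) : Cinf :=
  X (omega Y Z) - omega (nabla X Y) Z - omega Y (nabla X Z).

Definition is_levi_civita g nabla : Prop :=
  [/\ is_connection nabla,
      forall X Y : VF, nabla X Y - nabla Y X = lie_bracket X Y &
      forall X Y Z : VF, cov_deriv02 nabla g X Y Z = 0].

Definition is_product_structure (J : {linear VF -> VF}) : Prop :=
  forall X : VF, J (J X) = X.

Definition cov_deriv11 nabla (J : {linear VF -> VF}) (X Y : VF) : VF :=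
  nabla X (J Y) - J (nabla X Y).

Definition canonical_connection nabla (J : {linear VF -> VF}) (X Y : VF) : VF :=
  nabla X Y - smooth_cst 2^-1 *: cov_deriv11 nabla J X (J Y).

Definition curvature nabla (X Y Z : VF) : VF :=
  nabla X (nabla Y Z) - nabla Y (nabla X Z) - nabla (lie_bracket X Y) Z.

Definition ricci3 g nabla (e1 e2 e3 X Y : VF) : Cinf :=
  - g (curvature nabla X e1 Y) e1 - g (curvature nabla X e2 Y) e2
  + g (curvature nabla X e3 Y) e3.

Definition sym_ricci3 g nabla (e1 e2 e3 X Y : VF) : Cinf :=
  smooth_cst 2^-1 * (ricci3 g nabla e1 e2 e3 X Y + ricci3 g nabla e1 e2 e3 Y X).

Definition is_codazzi nabla omega : Prop :=
  forall X Y Z : VF,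
    cov_deriv02 nabla omega X Y Z - cov_deriv02 nabla omega Y X Z = 0.

End Geometry.

(* Main.v *)
Require Import Defs.
From mathcomp Require Import all_boot all_order all_algebra.
From mathcomp Require Import all_classical all_reals all_analysis.
From mathcomp Require Import perm ring lra.
Import Order.TTheory GRing.Theory Num.Theory.
Import numFieldNormedType.Exports.

(** The canonical connection preserves the splitting of the tangent bundle into
    the plane of [e1], [e2] and the line of [e3], together with the metric on
    both. It is therefore trivial on the line and acts on the plane by rotations:
    with the connection form w(X) = g(nablaL_X e1, e2), it sends e1 to w(X) e2, e2
    to - w(X) e1 and e3 to 0 ([canonical_e1], [canonical_e2], [canonical_e3]).
    Its curvature is the rotation of the plane by the exterior derivative of w.

    On G4 Koszul's formula gives w(e1) = 0, w(e2) = 1 and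
    w(e3) = alpha / 2 + eta ([rotation_form_G4]). The symmetrized Ricci tensor is
    then a constant multiple of the metric of the plane, which is parallel, plus
    D (e2* e3* + e3* e2* ) with D = (alpha / 2 + eta - beta) / 2. The covariant
    derivative of the second term along X is - w(X) D (e1* e3* + e3* e1* ). It has
    no component on (e2, e3), and w(e2) = 1, so the Codazzi equation on (e1, e2, e3)
    says exactly that D = 0; when D = 0 the tensor is parallel ([codazzi_G4]).

    Both the computation of the connection and the passage from the frame to
    arbitrary fields rest on the fact that [e1], [e2], [e3] span all vector fields
    over the smooth functions ([lie_algebra_basis3_frame]). This is proved from
    left invariance: a constant-coefficient relation at one point is propagated by
    translations to the whole group, so that the basis is free at every point
    ([lie_algebra_basis3_free]); Cramer's rule in charts then yields smooth
    coefficients ([pointwise_free_frame]). The analytic input is the stability of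
    the class C^k under composition and division. *)

Set Implicit Arguments.
Unset Strict Implicit.
Unset Printing Implicit Defensive.

Local Open Scope classical_set_scope.
Local Open Scope ring_scope.

(** * Calculus of C^k maps *)

Section CkCalculus.
Context {R : realType} {V : normedModType R}.
Implicit Types (U : set V).

(** [Ck k U f] is a conjunction of conditions at the single points of [U]. With one
   [U'] for all points this is also the restriction of a C^k map to a subset. *)
Lemma Ck_local {W : normedModType R} k U (f : V -> W) :
  (forall x, U x -> exists2 U', U' x & Ck k U' f) -> Ck k U f.
Proof.
elim: k f => [|k IH] f loc /=.
  by move=> x /loc[U' U'x Cf]; exact: Cf.
split=> [x /loc[U' U'x [df _]]|v]; first exact: df.
by apply: IH => x /loc[U' U'x [_ Df]]; exists U' => //; exact: Df.
Qed.

Lemma Ck_sum {W : normedModType R} k U (I : Type) (r : seq I) (P : pred I)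
    (F : I -> V -> W) : open U ->
  (forall i, P i -> Ck k U (F i)) -> Ck k U (fun x => \sum_(i <- r | P i) F i x).
Proof.
move=> oU CF.
have -> : (fun x => \sum_(i <- r | P i) F i x) = \sum_(i <- r | P i) F i.
  by apply/funext => x; rewrite fct_sumE.
by elim/big_ind: _ => //; [exact: Ck_cst|move=> f g; exact: CkD].
Qed.

Lemma Ck_prod k U (I : Type) (r : seq I) (P : pred I) (F : I -> V -> R) :
  open U ->
  (forall i, P i -> Ck k U (F i)) -> Ck k U (fun x => \prod_(i <- r | P i) F i x).
Proof.
move=> oU CF.
have -> : (fun x => \prod_(i <- r | P i) F i x) = \prod_(i <- r | P i) F i.
  by apply/funext => x; rewrite fct_prodE.
by elim/big_ind: _ => //; [exact: Ck_cst|move=> f g; exact: CkM].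
Qed.

(** The derivative of 1/f is - (1/f) (1/f) f', so the order drops by one in
   each factor and the induction goes through the product rule. *)
Lemma CkV k U (f : V -> R) : open U -> (forall x, U x -> f x != 0) ->
  Ck k U f -> Ck k U (fun x => (f x)^-1).
Proof.
move=> oU f0; elim: k => [|k IH] Cf.
  by move=> x Ux; apply: cvgV; [exact: f0|exact: Cf].
have [df Df] := Cf; split=> [x Ux|v].
  by apply: differentiableV; [exact: df|exact: f0].
have CV := IH (CkS Cf).
apply: (@Ck_eq _ _ _ _ _
  (- ((fun x => (f x)^-1) * (fun x => (f x)^-1) * 'D_v f))) => //.
  move=> x Ux; rewrite deriveV ?f0//; last exact/diff_derivable/df.
  rewrite -[RHS]/(- (f x) ^- 2 * 'D_v f x) !fctE expr2 invfM mulNr.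
  by [].
by apply: (CkN oU); apply: (CkM oU) (Df v); exact: (CkM oU CV CV).
Qed.

Lemma Ck_det k U m (A : V -> 'M[R]_m) : open U ->
  (forall i j, Ck k U (fun x => A x i j)) -> Ck k U (fun x => \det (A x)).
Proof.
move=> oU CA; apply: Ck_sum => // s _.
apply: (@CkM _ _ _ _ (cst ((-1) ^+ (s : 'S_m)))
  (fun x => \prod_i A x i ((s : 'S_m) i))) => //.
  exact: Ck_cst.
exact: Ck_prod.
Qed.

Lemma Ck_adj k U m (A : V -> 'M[R]_m) i j : open U ->
  (forall i j, Ck k U (fun x => A x i j)) -> Ck k U (fun x => (\adj (A x)) i j).
Proof.
move=> oU CA.
have -> : (fun x => (\adj (A x)) i j) =
    cst ((-1) ^+ (j + i)) * (fun x => \det (row' j (col' i (A x)))).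
  by apply/funext => x; rewrite mxE.
apply: CkM => //; first exact: Ck_cst.
apply: Ck_det => // a b.
have -> : (fun x => row' j (col' i (A x)) a b) =
    (fun x => A x (lift j a) (lift i b)) by apply/funext => x; rewrite !mxE.
exact: CA.
Qed.

Lemma Ck_coord k U m (g : V -> 'rV[R]_m) j : open U ->
  Ck k U g -> Ck k U (fun x => g x 0 j).
Proof.
move=> oU; elim: k g => [|k IH] g /= Cg.
  move=> x Ux; apply: (@continuous_comp _ _ _ g (fun N : 'rV[R]_m => N 0 j)).
    exact: Cg.
  exact: coord_continuous.
have [dg Dg] := Cg; split=> [x Ux|v].
  apply: (@differentiable_comp _ _ _ _ g (fun N : 'rV[R]_m => N 0 j)).
    exact: dg.
  exact: differentiable_coord.
apply: (@Ck_eq _ _ _ _ _ (fun x => 'D_v g x 0 j)) => //; last exact: IH.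
by move=> x Ux; rewrite derive_mx ?mxE//; exact/diff_derivable/dg.
Qed.

(** Chain rule in coordinates. Splitting the inner derivative along the
   standard basis leaves only directional derivatives of [f] in fixed
   directions, which are the ones that the definition of C^k controls. *)
Lemma derive_comp_rV m (g : V -> 'rV[R]_m) (f : 'rV[R]_m -> R) x v :
  differentiable g x -> differentiable f (g x) ->
  'D_v (fun y => f (g y)) x
  = \sum_(j < m) 'D_v g x 0 j * 'D_(delta_mx 0 j) f (g x).
Proof.
move=> dg df; rewrite deriveE; last exact: (differentiable_comp dg df).
rewrite (diff_comp dg df) /= -(deriveE v dg).
rewrite [in LHS](row_sum_delta ('D_v g x)) linear_sum.
by apply: eq_bigr => j _; rewrite linearZ /= -deriveE.
Qed.

Lemma Ck_comp k U m (Y : set 'rV[R]_m) (g : V -> 'rV[R]_m) (f : 'rV[R]_m -> R) :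
  open U -> (forall x, U x -> Y (g x)) ->
  Ck k U g -> Ck k Y f -> Ck k U (fun x => f (g x)).
Proof.
move=> oU UY; elim: k f => [|k IH] f Cg Cf.
  move=> x Ux; apply: (@continuous_comp _ _ _ g f); first exact: Cg.
  exact/Cf/UY.
have [dg Dg] := Cg; have [df Df] := Cf; split=> [x Ux|v].
  by apply: (@differentiable_comp _ _ _ _ g f); [exact: dg|exact/df/UY].
apply: (@Ck_eq _ _ _ _ _
    (fun x => \sum_(j < m) 'D_v g x 0 j * 'D_(delta_mx 0 j) f (g x))) => //.
  by move=> x Ux; rewrite derive_comp_rV//; [exact: dg|exact/df/UY].
apply: Ck_sum => // j _.
apply: (@CkM _ _ _ _ (fun x => 'D_v g x 0 j)
                     (fun x => 'D_(delta_mx 0 j) f (g x))) => //.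
  exact: (Ck_coord j oU (Dg v)).
exact: IH (CkS Cg) (Df _).
Qed.

(** Differentiating [fun x => f (c, x)] along [v] is differentiating [f] along
   [(0, v)], for every base point. *)
Lemma Ck_slice {W Z : normedModType R} k (U : set (W * V)) (c : W)
    (f : W * V -> Z) :
  Ck k U f -> Ck k [set x | U (c, x)] (fun x => f (c, x)).
Proof.
have dpc (x : V) : differentiable (fun y : V => (c, y)) x.
  by apply: differentiable_pair; [exact: differentiable_cst|exact: ex_diff].
elim: k f => [|k IH] f Cf.
  move=> x Ux; apply: (@continuous_comp _ _ _ (fun y => (c, y)) f).
    exact: differentiable_continuous (dpc x).
  exact: Cf.
have [df Df] := Cf; split=> [x Ux|v].
  exact: (@differentiable_comp _ _ _ _ (fun y => (c, y)) f x (dpc x) (df _ Ux)).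
have -> : 'D_v (fun x => f (c, x)) = (fun x => 'D_(0, v) f (c, x)).
  apply/funext => x.
  have E : (fun h : R =>
        h^-1 *: (((fun x => f (c, x)) \o shift x) (h *: v) - f (c, x))) =
      (fun h : R => h^-1 *: ((f \o shift (c, x)) (h *: (0, v)) - f (c, x))).
    apply/funext => h /=; congr (_ *: (f _ - _)).
    by apply/pair_eqP; rewrite /= scaler0 add0r !eqxx.
  by rewrite /derive E.
exact: (IH _ (Df _)).
Qed.

End CkCalculus.

(** * Left-invariant fields and frames *)

Section Frames.
Context {R : realType} {n : nat} {G : lieGroupType R n}.
Local Notation VF := (vector_field G).
Local Notation Cinf := (smoothfun G).

Lemma lmul_continuous {T : topologicalType} (a : G) (g : T -> G) (t : T) :
  {for t, continuous g} -> {for t, continuous (fun u => (a * g u)%g)}.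
Proof.
move=> gc; apply: (@continuous_comp _ _ _ (fun u => (a, g u))
                     (fun p : G * G => (p.1 * p.2)%g)).
  by apply: cvg_pair; [exact: cvg_cst|exact: gc].
exact: lie_mul_continuous.
Qed.

(** Near a given point, read [f] in a chart [chi] around its image and
   the product in charts [psi] around [a] and [phi]: the map becomes
   [f \o chi^-1] composed with a slice of the multiplication of the group. *)
Lemma is_smooth_translate (a : G) (f : Cinf) : is_smooth (fun p => f (a * p)%g).
Proof.
move=> phi aphi k; apply: Ck_local => y0 Uy0.
have [psi apsi psia] := atlas_cover a.
have [chi achi chip] := atlas_cover (a * chart_inv phi y0)%g.
pose U := [set y | chart_img phi y /\ chart_dom chi (a * chart_inv phi y)%g].
exists U => //.
have mulc y : chart_img phi y ->
    {for y, continuous (fun y => (a * chart_inv phi y)%g)}.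
  move=> Uy.
  exact: lmul_continuous (chart_inv_continuous Uy).
have oU : open U.
  rewrite openE => y [Uy Dy]; apply: filterI.
    exact: open_nbhs_nbhs (conj (@chart_img_open _ _ _ phi) Uy).
  apply: (mulc y Uy).
  exact: open_nbhs_nbhs (conj (@chart_dom_open _ _ _ chi) Dy).
have aK := chart_mapK psia; have Ia := chart_mapP psia.
pose g y := chi (chart_inv psi (psi a) * chart_inv phi y)%g.
have Cg : Ck k U g.
  apply: Ck_local => y [Uy Dy].
  exists [set y | [/\ chart_img psi (psi a), chart_img phi y &
            chart_dom chi (chart_inv psi (psi a) * chart_inv phi y)%g]].
    by split => //; rewrite aK.
  exact: (Ck_slice (psi a) (lie_mul_smooth psi phi chi apsi aphi achi k)).
apply: (@Ck_eq _ _ _ _ _ (fun y => f (chart_inv chi (g y)))) => //.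
  by move=> y [Uy Dy]; rewrite /g aK chart_mapK.
apply: (@Ck_comp _ _ _ _ _ (chart_img chi) g
          (fun z => f (chart_inv chi z)) oU _ Cg (smoothfun_chart f achi k)).
by move=> y [Uy Dy]; rewrite /g aK; exact: chart_mapP.
Qed.

Definition translate (a : G) (f : Cinf) : Cinf :=
  SmoothFun (asboolT (is_smooth_translate a f)).

(** The value of [V] at [q] is carried to [p] by the left translation by
   [q * p^-1]. *)
Lemma left_invariant_vanish (V : VF) (p : G) : left_invariant V ->
  (forall f : Cinf, V f p = 0) -> V = 0.
Proof.
move=> Vinv V0; apply: vector_field_eq => f; apply: smoothfun_eq => q.
have := Vinv (q * p^-1)%g f (translate (q * p^-1)%g f) (fun=> erefl) p.
by rewrite V0 mulgVK.
Qed.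

Lemma left_invariantD (X Y : VF) :
  left_invariant X -> left_invariant Y -> left_invariant (X + Y).
Proof.
move=> Xinv Yinv a f h fh p.
by rewrite [LHS](congr2 +%R (Xinv a f h fh p) (Yinv a f h fh p)).
Qed.

Lemma left_invariantZ (c : R) (X : VF) :
  left_invariant X -> left_invariant (smooth_cst c *: X).
Proof.
by move=> Xinv a f h fh p; rewrite [LHS](congr1 ( *%R c) (Xinv a f h fh p)).
Qed.

(** Linear independence of the [e i] at every point, tangent vectors being seen
   as derivations of the globally defined smooth functions. *)
Definition pointwise_free (e : 'I_n -> VF) := forall (p : G) (c : 'I_n -> R),
  (forall f : Cinf, \sum_i c i * e i f p = 0) -> forall i, c i = 0.

(** In a chart let [A] be the matrix of the components of the [e i]. A
   vector in its left kernel would be a relation between the [e i] at that point,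
   so [A] is invertible, and Cramer's rule gives the coefficients of [X] as smooth
   functions of the coordinates. Freeness also makes the coefficients unique, hence
   independent of the chart, so that the local ones glue.

   The definition of a vector field does not make its components in a chart
   unique, hence the formulation through the action on global functions. *)
Lemma pointwise_free_frame (e : 'I_n -> VF) (X : VF) : pointwise_free e ->
  exists b : 'I_n -> Cinf, X = \sum_i b i *: e i.
Proof.
move=> efree.
have chartwise (phi : chart R n G) : atlas phi ->
    exists2 b : 'I_n -> 'rV[R]_n -> R,
      forall i, smooth_on (chart_img phi) (b i) &
      forall x, chart_img phi x -> forall f : Cinf,
        X f (chart_inv phi x) = \sum_i b i x * e i f (chart_inv phi x).
  move=> aphi; have oU := @chart_img_open _ _ _ phi.
  have [a sa aE] := vector_fieldP X aphi.
  have /choice[E EP] i : exists E : 'I_n -> 'rV[R]_n -> R,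
      (forall j, smooth_on (chart_img phi) (E j)) /\
      forall (f : Cinf) x, chart_img phi x -> e i f (chart_inv phi x)
        = \sum_(j < n) E j x * pd j (fun y => f (chart_inv phi y)) x.
    by have [E sE EE] := vector_fieldP (e i) aphi; exists E.
  have sE i j : smooth_on (chart_img phi) (E i j) by case: (EP i).
  have EE i := (EP i).2.
  pose A x : 'M[R]_n := \matrix_(i, j) E i j x.
  have CA k i j : Ck k (chart_img phi) (fun x => A x i j).
    apply: (@Ck_eq _ _ _ _ _ (E i j)) => //; last exact: sE.
    by move=> x _; rewrite mxE.
  have detA x : chart_img phi x -> \det (A x) != 0.
    move=> Ux; apply/negP => /det0P[c /eqP c0 cA]; apply: c0.
    apply/rowP => i; rewrite mxE.
    apply: (efree (chart_inv phi x) (fun i => c 0 i)) => f.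
    under eq_bigr do rewrite EE// mulr_sumr.
    rewrite exchange_big big1// => j _.
    under eq_bigr do rewrite mulrA.
    rewrite -mulr_suml.
    have := congr1 (fun M : 'rV_n => M 0 j) cA; rewrite !mxE => cAj.
    (* the entry E i j x is folded back into A x to match the relation cAj *)
    by under eq_bigr do rewrite -[E _ _ _](mxE matrix_key (fun i j => E i j x));
      rewrite cAj mul0r.
  exists (fun i x => \sum_j a j x * \adj (A x) j i * (\det (A x))^-1).
    move=> i k; apply: Ck_sum => // j _.
    apply: (CkM oU (CkM oU (sa j k) (Ck_adj j i oU (CA k)))).
    exact: (CkV oU detA (Ck_det oU (CA k))).
  move=> x Ux f; rewrite aE//.
  under [RHS]eq_bigr do rewrite EE//.
  pose D j := pd j (fun y => f (chart_inv phi y)) x.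
  pose d := \col_j D j; pose r := \row_j a j x.
  have -> : \sum_i a i x * pd i (fun y => f (chart_inv phi y)) x
      = (r *m d) 0 0.
    by rewrite mxE; apply: eq_bigr => i _; rewrite !mxE.
  have -> : r *m d = (\det (A x))^-1 *: (r *m \adj (A x) *m (A x *m d)).
    rewrite mulmxA -(mulmxA r) mul_adj_mx mul_mx_scalar -scalemxAl.
    by rewrite scalerA mulVf ?detA// scale1r.
  rewrite mxE [X in _ * X]mxE mulr_sumr; apply: eq_bigr => i _.
  rewrite mulrA; congr (_ * _).
    by rewrite mulrC mxE mulr_suml; apply: eq_bigr => j _; rewrite !mxE.
  by rewrite mxE; apply: eq_bigr => j _; rewrite !mxE.
have /choice[b bE] p : exists b : 'I_n -> R,
    forall f : Cinf, X f p = \sum_i b i * e i f p.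
  have [phi aphi phip] := atlas_cover p; have [b _ bE] := chartwise phi aphi.
  exists (fun i => b i (phi p)) => f.
  have := bE (phi p) (chart_mapP phip) f; rewrite chart_mapK//.
have sb i : is_smooth (fun p => b p i).
  move=> phi aphi k; have [b' sb' b'E] := chartwise phi aphi.
  apply: (@Ck_eq _ _ _ _ _ (b' i)); last exact: sb'.
    exact: chart_img_open.
  move=> x Ux; apply/eqP; rewrite -subr_eq0; apply/eqP.
  apply: (efree (chart_inv phi x) (fun i => b' i x - b (chart_inv phi x) i)).
  move=> f; under eq_bigr do rewrite mulrBl.
  by rewrite sumrB -b'E// -bE subrr.
exists (fun i => SmoothFun (asboolT (sb i))).
apply: vector_field_eq => f; apply: smoothfun_eq => p; rewrite bE.
have sumE (F : 'I_n -> VF) : (\sum_i F i) f p = \sum_i F i f p.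
  by elim/big_ind2: _ => // Y y Z z <- <-.
by rewrite sumE.
Qed.

End Frames.

(** A relation at one point, extended with the same constant coefficients,
   is a left-invariant field vanishing at that point; it is therefore zero, and the
   uniqueness of coordinates in the Lie algebra kills the coefficients. *)
Lemma lie_algebra_basis3_free {R : realType} {G : lieGroupType R 3}
    (e1 e2 e3 : vector_field G) :
  lie_algebra_basis3 e1 e2 e3 ->
  pointwise_free (fun i : 'I_3 => [:: e1; e2; e3]`_i).
Proof.
case=> inv1 inv2 inv3 ebasis p c c0.
have [c' [_ c'uniq]] := ebasis 0 (fun a f h _ p => erefl).
have Vinv := left_invariantD
  (left_invariantD (left_invariantZ (c ord0) inv1)
                   (left_invariantZ (c (inord 1)) inv2))
  (left_invariantZ (c (inord 2)) inv3).
have V0 := left_invariant_vanish Vinv (p := p).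
have o1 : lift ord0 ord0 = inord 1 :> 'I_3 by apply: val_inj; rewrite /= inordK.
have o2 : lift ord0 (lift ord0 ord0) = inord 2 :> 'I_3.
  by apply: val_inj; rewrite /= inordK.
have {}V0 : smooth_cst (c ord0) *: e1 + smooth_cst (c (inord 1)) *: e2
    + smooth_cst (c (inord 2)) *: e3 = 0.
  apply: V0 => f; have := c0 f.
  by rewrite !big_ord_recl big_ord0 o1 o2 /= !inordK//= addr0 addrA.
have E1 := c'uniq (c ord0, c (inord 1), c (inord 2)) (esym V0).
have E2 : c' = (0, 0, 0).
  apply: c'uniq; rewrite /=.
  have -> : smooth_cst 0 = 0 :> smoothfun G by apply: smoothfun_eq.
  by rewrite !scale0r !addr0.
move: E1; rewrite E2 => -[h1 h2 h3].
case=> -[|[|[|//]]] i3.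
- by rewrite [Ordinal _](_ : _ = ord0)//; exact: val_inj.
- by rewrite [Ordinal _](_ : _ = inord 1)//; apply: val_inj; rewrite /= inordK.
- by rewrite [Ordinal _](_ : _ = inord 2)//; apply: val_inj; rewrite /= inordK.
Qed.

(** The reduction of tensor identities to three fields: the left-invariant basis,
   given over the reals, also spans all fields over the smooth functions. *)
Lemma lie_algebra_basis3_frame {R : realType} {G : lieGroupType R 3}
    (e1 e2 e3 X : vector_field G) :
  lie_algebra_basis3 e1 e2 e3 ->
  exists b1 b2 b3 : smoothfun G, X = b1 *: e1 + b2 *: e2 + b3 *: e3.
Proof.
move=> /lie_algebra_basis3_free/(pointwise_free_frame X)[b ->].
by do 3!eexists; rewrite !big_ord_recl big_ord0 addr0 addrA.
Qed.

(** * Vector fields as derivations *)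

Section Derivations.
Context {R : realType} {n : nat} {G : lieGroupType R n}.
Local Notation VF := (vector_field G).
Local Notation Cinf := (smoothfun G).
Implicit Types (X Y Z : VF) (f h : Cinf).

Lemma vector_field_cst X (c : R) : X (smooth_cst c) = 0.
Proof.
apply: smoothfun_eq => p; have [phi aphi phip] := atlas_cover p.
have [a _ aE] := vector_fieldP X aphi.
rewrite -(chart_mapK phip) aE; last exact: chart_mapP.
by rewrite big1// => i _; rewrite /pd derive_cst mulr0.
Qed.

Lemma smoothfun_derivable f (phi : chart R n G) x v : atlas phi ->
  chart_img phi x -> derivable (fun y => f (chart_inv phi y)) x v.
Proof.
move=> aphi Ux; apply: diff_derivable.
by have [df _] := smoothfun_chart f aphi 1%N; exact: df.
Qed.

Lemma vector_fieldD X f h : X (f + h) = X f + X h.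
Proof.
apply: smoothfun_eq => p; have [phi aphi phip] := atlas_cover p.
have [a _ aE] := vector_fieldP X aphi; have Ux := chart_mapP phip.
have -> : (X f + X h) p = X f p + X h p by [].
rewrite -(chart_mapK phip) !aE// -big_split; apply: eq_bigr => i _ /=.
rewrite -mulrDr; congr (_ * _).
by rewrite -deriveD//; exact: smoothfun_derivable.
Qed.

Lemma vector_fieldM X f h : X (f * h) = f * X h + X f * h.
Proof.
apply: smoothfun_eq => p; have [phi aphi phip] := atlas_cover p.
have [a _ aE] := vector_fieldP X aphi; have Ux := chart_mapP phip.
have -> : (f * X h + X f * h) p = f p * X h p + X f p * h p by [].
rewrite -(chart_mapK phip) !aE// mulr_sumr mulr_suml -big_split.
apply: eq_bigr => i _ /=.
have dM := @deriveM _ _ _ _ (chart_map phi p) (delta_mx 0 i)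
  (smoothfun_derivable (f := f) aphi Ux) (smoothfun_derivable (f := h) aphi Ux).
rewrite /pd [X in _ * X]dM /GRing.scale /=; ring.
Qed.

Lemma lie_bracket_linearl f X Y Z :
  lie_bracket (f *: X + Y) Z = f *: lie_bracket X Z + ((- Z f) *: X + lie_bracket Y Z).
Proof.
apply: vector_field_eq => h /=; rewrite vector_fieldD vector_fieldM; ring.
Qed.

Lemma lie_bracketC X Y : lie_bracket X Y = - lie_bracket Y X.
Proof. by apply: vector_field_eq => h /=; rewrite opprB. Qed.

Lemma lie_bracketxx X : lie_bracket X X = 0.
Proof. by apply: vector_field_eq => h /=; rewrite subrr. Qed.

End Derivations.

(** * Tensors, connections and curvature *)

Section TensorCalculus.
Context {R : realType} {n : nat} {G : lieGroupType R n}.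
Local Notation VF := (vector_field G).
Local Notation Cinf := (smoothfun G).
Implicit Types (nabla : VF -> VF -> VF) (omega g : VF -> VF -> Cinf).
Implicit Types (X Y Z W : VF) (f : Cinf).

Definition Cinf_linear (L : VF -> Cinf) :=
  forall f X Y, L (f *: X + Y) = f * L X + L Y.

Lemma Cinf_linearD L X Y : Cinf_linear L -> L (X + Y) = L X + L Y.
Proof. by move=> /(_ 1 X Y); rewrite scale1r mul1r. Qed.

Lemma Cinf_linear0 L : Cinf_linear L -> L 0 = 0.
Proof.
by move=> /(Cinf_linearD 0 0)/eqP; rewrite addr0 -[X in X == _]addr0
  (inj_eq (addrI _)) eq_sym => /eqP.
Qed.

Lemma Cinf_linearZ L f X : Cinf_linear L -> L (f *: X) = f * L X.
Proof. by move=> linL; rewrite -[f *: X]addr0 linL (Cinf_linear0 linL) addr0. Qed.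

Lemma Cinf_linearN L X : Cinf_linear L -> L (- X) = - L X.
Proof. by move=> linL; rewrite -scaleN1r Cinf_linearZ// mulN1r. Qed.

Lemma Cinf_linear_frame3 L (e1 e2 e3 X : VF) : Cinf_linear L ->
  (exists b1 b2 b3 : Cinf, X = b1 *: e1 + b2 *: e2 + b3 *: e3) ->
  L e1 = 0 -> L e2 = 0 -> L e3 = 0 -> L X = 0.
Proof.
move=> linL [b1 [b2 [b3 ->]]] L1 L2 L3.
by rewrite !Cinf_linearD// !Cinf_linearZ// L1 L2 L3 !mulr0 !addr0.
Qed.

Lemma tensor02_linearl omega Z :
  is_tensor02 omega -> Cinf_linear (fun X => omega X Z).
Proof. by move=> [lin _] f X Y; exact: lin. Qed.

Lemma tensor02_linearr omega X : is_tensor02 omega -> Cinf_linear (omega X).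
Proof. by move=> [_ lin] f Y Z; exact: lin. Qed.

Lemma connectionDl nabla X Y Z : is_connection nabla ->
  nabla (X + Y) Z = nabla X Z + nabla Y Z.
Proof. by move=> [/(_ 1 X Y Z) + _ _]; rewrite !scale1r. Qed.

Lemma connection0l nabla Z : is_connection nabla -> nabla 0 Z = 0.
Proof.
move=> cn; apply: (@addrI _ (nabla 0 Z)).
by rewrite -connectionDl// !addr0.
Qed.

Lemma connection0r nabla X : is_connection nabla -> nabla X 0 = 0.
Proof.
move=> [_ cn _]; apply: (@addrI _ (nabla X 0)).
by rewrite -cn !addr0.
Qed.

(** The derivative of [f] produced by [nabla Z (f *: nabla X W)] cancels
   the one produced by the bracket. *)
Lemma curvature_linear1 nabla f X Y Z W : is_connection nabla ->
  curvature nabla (f *: X + Y) Z W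
  = f *: curvature nabla X Z W + curvature nabla Y Z W.
Proof.
move=> [linl linr leib]; rewrite /curvature lie_bracket_linearl !linl linr leib.
by apply: vector_field_eq => h /=; ring.
Qed.

(** The second derivatives of [f] combine into [X (Y f) - Y (X f)], which
   is what the bracket term removes; the mixed first-order terms cancel in pairs. *)
Lemma curvature_linear3 nabla f X Y Z W : is_connection nabla ->
  curvature nabla X Y (f *: Z + W)
  = f *: curvature nabla X Y Z + curvature nabla X Y W.
Proof.
move=> [linl linr leib]; rewrite /curvature !linr !leib !linr !leib.
by apply: vector_field_eq => h /=; ring.
Qed.

Lemma ricci3_tensor g nabla (e1 e2 e3 : VF) :
  is_tensor02 g -> is_connection nabla -> is_tensor02 (ricci3 g nabla e1 e2 e3).
Proof.
move=> [gl _] cn; split=> f X Y Z; rewrite /ricci3.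
  by rewrite !curvature_linear1// !gl; ring.
by rewrite !curvature_linear3// !gl; ring.
Qed.

Lemma sym_ricci3_tensor g nabla (e1 e2 e3 : VF) :
  is_tensor02 g -> is_connection nabla ->
  is_tensor02 (sym_ricci3 g nabla e1 e2 e3).
Proof.
move=> tg cn; have [rl rr] := ricci3_tensor e1 e2 e3 tg cn.
by split=> f X Y Z; rewrite /sym_ricci3 rl rr; ring.
Qed.

Lemma cov_deriv02_linear2 nabla omega X Z :
  is_tensor02 omega -> is_connection nabla ->
  Cinf_linear (fun Y => cov_deriv02 nabla omega X Y Z).
Proof.
move=> [ol or] [_ linr leib] f Y W; rewrite /cov_deriv02 linr leib -!addrA !ol.
by rewrite vector_fieldD vector_fieldM; ring.
Qed.

Lemma cov_deriv02_linear3 nabla omega X Y :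
  is_tensor02 omega -> is_connection nabla ->
  Cinf_linear (cov_deriv02 nabla omega X Y).
Proof.
move=> [ol or] [_ linr leib] f Z W; rewrite /cov_deriv02 linr leib -!addrA !or.
by rewrite vector_fieldD vector_fieldM; ring.
Qed.

Lemma smooth_half : smooth_cst 2^-1 + smooth_cst 2^-1 = 1 :> Cinf.
Proof. by apply: smoothfun_eq => p; rewrite -[RHS]/(1 : R) [RHS]splitr div1r. Qed.

(** The canonical connection averages the connection and its conjugate by
   [J]: it keeps the part of [nabla X Y] that preserves the eigenbundles of [J]. *)
Lemma canonical_connectionE nabla (J : {linear VF -> VF}) X Y :
  is_product_structure J ->
  canonical_connection nabla J X Y
  = smooth_cst 2^-1 *: (nabla X Y + J (nabla X (J Y))).
Proof.
move=> JJ; rewrite /canonical_connection /cov_deriv11 JJ.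
rewrite -{1}[nabla X Y]scale1r -smooth_half.
by apply: vector_field_eq => h /=; ring.
Qed.

Lemma canonical_connectionP nabla (J : {linear VF -> VF}) :
  is_product_structure J -> is_connection nabla ->
  is_connection (canonical_connection nabla J).
Proof.
move=> JJ [linl linr leib].
have JD X Y : J (X + Y) = J X + J Y := linearD J X Y.
have JZ f X : J (f *: X) = f *: J X := linearZ_LR J f X.
split=> [f X Y Z|X Y Z|f X Y]; rewrite !canonical_connectionE//.
- by rewrite !linl JD JZ; apply: vector_field_eq => h /=; ring.
- by rewrite JD !linr JD; apply: vector_field_eq => h /=; ring.
- rewrite JZ !leib JD !JZ JJ.
  rewrite -[X f *: Y in RHS]scale1r -smooth_half.
  by apply: vector_field_eq => h /=; ring.
Qed.

End TensorCalculus.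

(** * The canonical connection in an adapted frame *)

Section Evaluation.
Context {R : realType} {n : nat} {G : lieGroupType R n}.
Local Notation Cinf := (smoothfun G).

Lemma smoothfun_evalE (p : G) :
  (forall f h : Cinf, (f + h) p = f p + h p) *
  (forall f h : Cinf, (f * h) p = f p * h p) *
  (forall f : Cinf, (- f) p = - f p) *
  ((0 : Cinf) p = 0) * ((1 : Cinf) p = 1) *
  (forall c : R, (smooth_cst c : Cinf) p = c).
Proof. by []. Qed.

End Evaluation.

Section CanonicalConnection.
Context {R : realType} {G : lieGroupType R 3}.
Local Notation VF := (vector_field G).
Local Notation Cinf := (smoothfun G).
Context (g : VF -> VF -> Cinf) (e1 e2 e3 : VF) (nablaL : VF -> VF -> VF)
  (J : {linear VF -> VF}).
Context (g_tensor : is_tensor02 g) (g_sym : forall X Y, g X Y = g Y X)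
  (e_frame : forall X : VF, exists b1 b2 b3 : Cinf,
     X = b1 *: e1 + b2 *: e2 + b3 *: e3)
  (e_orthonormal : pseudo_orthonormal3 g e1 e2 e3)
  (nablaL_levi_civita : is_levi_civita g nablaL)
  (J_product : is_product_structure J)
  (J1 : J e1 = e1) (J2 : J e2 = e2) (J3 : J e3 = - e3).
Implicit Types X Y Z : VF.

Let gl Z := tensor02_linearl Z g_tensor.
Let lcP : is_connection nablaL. Proof. by case: nablaL_levi_civita. Qed.

Let nablac := canonical_connection nablaL J.
Let nablacP : is_connection nablac := canonical_connectionP J_product lcP.

Let gE : (g e1 e1 = 1) * (g e2 e2 = 1) * (g e3 e3 = -1) *
  (g e1 e2 = 0) * (g e1 e3 = 0) * (g e2 e3 = 0) *
  (g e2 e1 = 0) * (g e3 e1 = 0) * (g e3 e2 = 0).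
Proof. by case: e_orthonormal => -[-> -> ->] [-> -> -> -> [-> ->]]. Qed.

(** The sign of the last term is [g e3 e3 = -1]. *)
Lemma frame_expansion X : X = g X e1 *: e1 + g X e2 *: e2 - g X e3 *: e3.
Proof.
have [b1 [b2 [b3 XE]]] := e_frame X.
have [E1 [E2 E3]] : g X e1 = b1 /\ g X e2 = b2 /\ g X e3 = - b3.
  rewrite XE !(Cinf_linearD _ _ (gl _)) !(Cinf_linearZ _ _ (gl _)) !gE.
  by rewrite !mulr0 !mulr1 mulrN1 !addr0 !add0r.
by rewrite E1 E2 E3 scaleNr opprK.
Qed.

(** Metric compatibility, where the derivative of the constant [g Y Z]
   drops out. *)
Lemma levi_civita_skew X Y Z (c : R) : g Y Z = smooth_cst c ->
  g (nablaL X Y) Z = - g (nablaL X Z) Y.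
Proof.
move=> gYZ; have [_ _ /(_ X Y Z)] := nablaL_levi_civita.
rewrite /cov_deriv02 gYZ vector_field_cst sub0r => /eqP.
by rewrite -opprD oppr_eq0 addr_eq0 (g_sym Y) => /eqP.
Qed.

Let cst0 : smooth_cst 0 = 0 :> Cinf. Proof. exact: smoothfun_eq. Qed.
Let cst1 : smooth_cst 1 = 1 :> Cinf. Proof. exact: smoothfun_eq. Qed.
Let cstN1 : smooth_cst (-1) = -1 :> Cinf. Proof. exact: smoothfun_eq. Qed.

Lemma levi_civita_skew0 X Y (c : R) : g Y Y = smooth_cst c ->
  g (nablaL X Y) Y = 0.
Proof.
move=> gYY; apply: smoothfun_eq => p.
have := congr1 (fun f : Cinf => f p) (levi_civita_skew X gYY).
rewrite !smoothfun_evalE; lra.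
Qed.

Let n11 X : g (nablaL X e1) e1 = 0.
Proof. by apply: (@levi_civita_skew0 _ _ 1); rewrite gE cst1. Qed.
Let n22 X : g (nablaL X e2) e2 = 0.
Proof. by apply: (@levi_civita_skew0 _ _ 1); rewrite gE cst1. Qed.
Let n33 X : g (nablaL X e3) e3 = 0.
Proof. by apply: (@levi_civita_skew0 _ _ (-1)); rewrite gE cstN1. Qed.
Let n21 X : g (nablaL X e2) e1 = - g (nablaL X e1) e2.
Proof. by apply: (@levi_civita_skew _ _ _ 0); rewrite gE cst0. Qed.
Let n31 X : g (nablaL X e3) e1 = - g (nablaL X e1) e3.
Proof. by apply: (@levi_civita_skew _ _ _ 0); rewrite gE cst0. Qed.
Let n32 X : g (nablaL X e3) e2 = - g (nablaL X e2) e3.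
Proof. by apply: (@levi_civita_skew _ _ _ 0); rewrite gE cst0. Qed.

(** The canonical connection keeps the plane of [e1], [e2] and the line of [e3]
   apart and respects the metric on both; it is trivial on the line and rotates the
   plane, so this one connection form encodes it completely. *)
Definition rotation_form X : Cinf := g (nablaL X e1) e2.
Local Notation w := rotation_form.

Lemma rotation_form_linear : Cinf_linear w.
Proof.
by case: lcP => lin _ _ f X Y; rewrite /w lin gl.
Qed.

Let J_frame X :
  J X = g X e1 *: e1 + g X e2 *: e2 + g X e3 *: e3.
Proof.
have JD Y Z : J (Y + Z) = J Y + J Z := linearD J Y Z.
have JZ f Y : J (f *: Y) = f *: J Y := linearZ_LR J f Y.
by rewrite {1}(frame_expansion X) -scaleNr !JD !JZ J1 J2 J3 scalerN scaleNr opprK.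
Qed.

Let halfZ (Y : VF) : smooth_cst 2^-1 *: (Y + Y) = Y.
Proof. by rewrite scalerDr -scalerDl smooth_half scale1r. Qed.

Lemma canonical_e1 X : nablac X e1 = w X *: e2.
Proof.
rewrite /nablac canonical_connectionE// J1 J_frame.
rewrite [X in _ *: (X + _)]frame_expansion n11 scale0r add0r.
by rewrite addrACA addNr addr0 halfZ.
Qed.

Lemma canonical_e2 X : nablac X e2 = - w X *: e1.
Proof.
rewrite /nablac canonical_connectionE// J2 J_frame.
rewrite [X in _ *: (X + _)]frame_expansion n22 n21 scale0r addr0.
by rewrite addrACA addNr addr0 halfZ.
Qed.

Lemma canonical_e3 X : nablac X e3 = 0.
Proof.
have lcN : nablaL X (- e3) = - nablaL X e3.
  apply: (@addrI _ (nablaL X e3)); case: (lcP) => _ <- _.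
  by rewrite !subrr connection0r.
rewrite /nablac canonical_connectionE// J3 lcN.
have JN Y : J (- Y) = - J Y := linearN J Y.
rewrite JN J_frame [X in _ *: (X + _)]frame_expansion n33 !scale0r.
by rewrite oppr0 !addr0 subrr scaler0.
Qed.

(** The exterior derivative of the connection form. As the rotations of a plane
   commute, the curvature has no quadratic term. *)
Definition rotation_curvature X Y : Cinf :=
  X (w Y) - Y (w X) - w (lie_bracket X Y).
Local Notation Omega := rotation_curvature.

Lemma curvature_e1 X Y : curvature nablac X Y e1 = Omega X Y *: e2.
Proof.
case: nablacP => _ _ leib.
rewrite /curvature !canonical_e1 !leib !canonical_e2.
by apply: vector_field_eq => h /=; rewrite /Omega; ring.
Qed.

Lemma curvature_e2 X Y : curvature nablac X Y e2 = - Omega X Y *: e1.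
Proof.
case: nablacP => _ _ leib.
have XN Z f : Z (- f) = - Z f.
  rewrite -mulN1r vector_fieldM -cstN1 vector_field_cst mul0r addr0 cstN1.
  by rewrite mulN1r.
rewrite /curvature !canonical_e2 !leib !canonical_e1 !XN.
by apply: vector_field_eq => h /=; rewrite /Omega; ring.
Qed.

Lemma curvature_e3 X Y : curvature nablac X Y e3 = 0.
Proof. by rewrite /curvature !canonical_e3 !connection0r// !subr0. Qed.

Let ric := ricci3 g nablac e1 e2 e3.

Lemma ricci_e1 X : ric X e1 = - Omega X e2.
Proof.
rewrite /ric /ricci3 !curvature_e1 !(Cinf_linearZ _ _ (gl _)) !gE.
by rewrite !mulr0 mulr1 oppr0 add0r addr0.
Qed.

Lemma ricci_e2 X : ric X e2 = Omega X e1.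
Proof.
rewrite /ric /ricci3 !curvature_e2 !(Cinf_linearZ _ _ (gl _)) !gE.
by rewrite !mulr0 mulr1 opprK subr0 addr0.
Qed.

Lemma ricci_e3 X : ric X e3 = 0.
Proof.
rewrite /ric /ricci3 !curvature_e3 !(Cinf_linear0 (gl _)).
by rewrite !oppr0 !addr0.
Qed.

Lemma rotation_curvatureC X Y : Omega X Y = - Omega Y X.
Proof.
rewrite /Omega (lie_bracketC X) (Cinf_linearN _ rotation_form_linear); ring.
Qed.

Lemma rotation_curvaturexx X : Omega X X = 0.
Proof.
by rewrite /Omega subrr lie_bracketxx (Cinf_linear0 rotation_form_linear) subrr.
Qed.

Let S := sym_ricci3 g nablac e1 e2 e3.

Lemma sym_ricci_e11 : S e1 e1 = - Omega e1 e2.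
Proof.
rewrite /S /sym_ricci3 -/ric ricci_e1 mulrDr -mulrDl smooth_half mul1r//.
Qed.

Lemma sym_ricci_e22 : S e2 e2 = - Omega e1 e2.
Proof.
rewrite /S /sym_ricci3 -/ric ricci_e2 rotation_curvatureC.
by rewrite mulrDr -mulrDl smooth_half mul1r.
Qed.

Lemma sym_ricciC X Y : S X Y = S Y X.
Proof. by rewrite /S /sym_ricci3 addrC. Qed.

Lemma sym_ricci_e12 : S e1 e2 = 0.
Proof.
by rewrite /S /sym_ricci3 -/ric ricci_e1 ricci_e2 !rotation_curvaturexx oppr0
  addr0 mulr0.
Qed.

Lemma sym_ricci_e13 : S e1 e3 = - (smooth_cst 2^-1 * Omega e3 e2).
Proof. by rewrite /S /sym_ricci3 -/ric ricci_e1 ricci_e3 add0r mulrN. Qed.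

Lemma sym_ricci_e23 : S e2 e3 = smooth_cst 2^-1 * Omega e3 e1.
Proof. by rewrite /S /sym_ricci3 -/ric ricci_e2 ricci_e3 add0r. Qed.

Lemma sym_ricci_e33 : S e3 e3 = 0.
Proof. by rewrite /S /sym_ricci3 -/ric ricci_e3 addr0 mulr0. Qed.

Context (alpha beta eta : R)
  (bracket12 : lie_bracket e1 e2 = - e2 + smooth_cst (2 * eta - beta) *: e3)
  (bracket13 : lie_bracket e1 e3 = - (smooth_cst beta *: e2) + e3)
  (bracket23 : lie_bracket e2 e3 = smooth_cst alpha *: e1).

(** Koszul's formula on the frame, obtained as the solution of the linear
   system formed by skew-symmetry and vanishing torsion. For [w e3] the three
   brackets are combined: twice the value is [alpha + beta + (2 * eta - beta)]. *)
Lemma rotation_form_G4 :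
  [/\ w e1 = 0, w e2 = 1 & w e3 = smooth_cst (alpha / 2 + eta)].
Proof.
have [_ torsion _] := nablaL_levi_civita.
have ev X Y Z p : g (nablaL X Y) Z p - g (nablaL Y X) Z p = g (lie_bracket X Y) Z p.
  rewrite -torsion (Cinf_linearD _ _ (gl _)) (Cinf_linearN _ (gl _)).
  by rewrite !smoothfun_evalE.
have s21 X p : g (nablaL X e2) e1 p = - g (nablaL X e1) e2 p.
  by rewrite n21 smoothfun_evalE.
have s31 X p : g (nablaL X e3) e1 p = - g (nablaL X e1) e3 p.
  by rewrite n31 smoothfun_evalE.
have s32 X p : g (nablaL X e3) e2 p = - g (nablaL X e2) e3 p.
  by rewrite n32 smoothfun_evalE.
have s11 X p : g (nablaL X e1) e1 p = 0 by rewrite n11 smoothfun_evalE.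
have s22 X p : g (nablaL X e2) e2 p = 0 by rewrite n22 smoothfun_evalE.
split; apply: smoothfun_eq => p; rewrite /w !smoothfun_evalE.
- have := ev e1 e2 e1 p; rewrite bracket12.
  rewrite (Cinf_linearD _ _ (gl _)) (Cinf_linearN _ (gl _)) (Cinf_linearZ _ _ (gl _)).
  rewrite !gE !smoothfun_evalE s21 s11; lra.
- have := ev e1 e2 e2 p; rewrite bracket12.
  rewrite (Cinf_linearD _ _ (gl _)) (Cinf_linearN _ (gl _)) (Cinf_linearZ _ _ (gl _)).
  rewrite !gE !smoothfun_evalE s22; lra.
- have := ev e1 e2 e3 p; have := ev e1 e3 e2 p; have := ev e2 e3 e1 p.
  rewrite bracket12 bracket13 bracket23.
  rewrite !(Cinf_linearD _ _ (gl _)) !(Cinf_linearN _ (gl _)) !(Cinf_linearZ _ _ (gl _)).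
  rewrite !gE !smoothfun_evalE s31 s32 s21; lra.
Qed.

Lemma rotation_curvature_G4 :
  [/\ Omega e1 e2 = smooth_cst (1 - (2 * eta - beta) * (alpha / 2 + eta)),
      Omega e1 e3 = smooth_cst (beta - (alpha / 2 + eta)) &
      Omega e2 e3 = 0].
Proof.
have [w1 w2 w3] := rotation_form_G4; have wl := rotation_form_linear.
rewrite /Omega w1 w2 w3 bracket12 bracket13 bracket23.
rewrite !(Cinf_linearD _ _ wl) !(Cinf_linearN _ wl) !(Cinf_linearZ _ _ wl).
rewrite w1 w2 w3 -cst0 -cst1 !vector_field_cst.
by split; apply: smoothfun_eq => p; rewrite !smoothfun_evalE; ring.
Qed.

(** The diagonal entries [- K] form a multiple of the metric of the plane, which is
   parallel, so only [D] contributes to the covariant derivative, and only on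
   [(e1, e3)], by [- w X * D]. The Codazzi equation on [(e1, e2, e3)] is therefore
   [w e2 * D = 0]. *)
Lemma codazzi_G4 : is_codazzi nablac S <-> alpha / 2 + eta - beta = 0.
Proof.
have [w1 w2 w3] := rotation_form_G4.
have [Om12 Om13 Om23] := rotation_curvature_G4.
pose K := 1 - (2 * eta - beta) * (alpha / 2 + eta).
pose D := 2^-1 * (alpha / 2 + eta - beta).
have S11 : S e1 e1 = smooth_cst (- K).
  by rewrite sym_ricci_e11 Om12; exact: smoothfun_eq.
have S22 : S e2 e2 = smooth_cst (- K).
  by rewrite sym_ricci_e22 Om12; exact: smoothfun_eq.
have S13 : S e1 e3 = 0.
  by rewrite sym_ricci_e13 rotation_curvatureC Om23 oppr0 mulr0 oppr0.
have S23 : S e2 e3 = smooth_cst D.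
  rewrite sym_ricci_e23 rotation_curvatureC Om13; apply: smoothfun_eq => p.
  by rewrite !smoothfun_evalE /D; ring.
have tS : is_tensor02 S := sym_ricci3_tensor e1 e2 e3 g_tensor nablacP.
have sl Z := tensor02_linearl Z tS.
have sr Z := tensor02_linearr Z tS.
have SE := (S11, S22, S13, S23, sym_ricci_e12, sym_ricci_e33,
  etrans (sym_ricciC e2 e1) sym_ricci_e12, etrans (sym_ricciC e3 e1) S13,
  etrans (sym_ricciC e3 e2) S23).
have X0 X : X 0 = 0 by rewrite -cst0 vector_field_cst.
have cov12 X : cov_deriv02 nablac S X e1 e2 = 0.
  rewrite /cov_deriv02 canonical_e1 canonical_e2.
  by rewrite (Cinf_linearZ _ _ (sl _)) (Cinf_linearZ _ _ (sr _)) !SE X0; ring.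
have cov13 X : cov_deriv02 nablac S X e1 e3 = - w X * smooth_cst D.
  rewrite /cov_deriv02 canonical_e1 canonical_e3 (Cinf_linear0 (sr _)).
  by rewrite (Cinf_linearZ _ _ (sl _)) !SE X0; ring.
have cov23 X : cov_deriv02 nablac S X e2 e3 = 0.
  rewrite /cov_deriv02 canonical_e2 canonical_e3 (Cinf_linear0 (sr _)).
  by rewrite (Cinf_linearZ _ _ (sl _)) !SE vector_field_cst; ring.
split=> [codS|D0].
  have := congr1 (fun f : Cinf => f 1%g) (codS e1 e2 e3).
  rewrite cov23 cov13 w2 !smoothfun_evalE /D; lra.
have covC X Y Z : cov_deriv02 nablac S X Y Z = cov_deriv02 nablac S X Z Y.
  rewrite /cov_deriv02 (sym_ricciC Y) (sym_ricciC (nablac X Y)).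
  by rewrite (sym_ricciC Y); ring.
have c13 X : cov_deriv02 nablac S X e1 e3 = 0.
  by rewrite cov13 /D D0 mulr0 cst0 mulr0.
have cov11 X : cov_deriv02 nablac S X e1 e1 = 0.
  rewrite /cov_deriv02 canonical_e1 (Cinf_linearZ _ _ (sl _)).
  by rewrite (Cinf_linearZ _ _ (sr _)) !SE vector_field_cst; ring.
have cov22 X : cov_deriv02 nablac S X e2 e2 = 0.
  rewrite /cov_deriv02 canonical_e2 (Cinf_linearZ _ _ (sl _)).
  by rewrite (Cinf_linearZ _ _ (sr _)) !SE vector_field_cst; ring.
have cov33 X : cov_deriv02 nablac S X e3 e3 = 0.
  rewrite /cov_deriv02 canonical_e3 (Cinf_linear0 (sl _)) (Cinf_linear0 (sr _)).
  by rewrite !SE X0; ring.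
(* Y and Z are expanded in the frame; X stays arbitrary throughout *)
suff parallel X Y Z : cov_deriv02 nablac S X Y Z = 0.
  by move=> X Y Z; rewrite !parallel subrr.
have l2 W := cov_deriv02_linear2 X W tS nablacP.
have l3 W := cov_deriv02_linear3 X W tS nablacP.
have on_e k : [\/ k = e1, k = e2 | k = e3] -> cov_deriv02 nablac S X Y k = 0.
  move=> ek; apply: (Cinf_linear_frame3 (l2 k) (e_frame Y));
  by case: ek => ->; rewrite // covC.
by apply: (Cinf_linear_frame3 (l3 Y) (e_frame Z)); apply: on_e;
  [exact: Or31|exact: Or32|exact: Or33].
Qed.

End CanonicalConnection.

(** * The Codazzi condition *)

Theorem theorem4p14 (R : realType) (alpha beta eta : R)
  (G4 : lieGroupType R 3)
  (g : vector_field G4 -> vector_field G4 -> smoothfun G4)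
  (e1 e2 e3 : vector_field G4)
  (nablaL : vector_field G4 -> vector_field G4 -> vector_field G4)
  (J : {linear vector_field G4 -> vector_field G4})
  (eta_pm1 : eta = 1 \/ eta = -1)
  (G4_connected : connected [set: G4])
  (G4_simply_connected : simply_connected R G4)
  (g_lorentzian : is_lorentzian_metric g)
  (g_left_invariant : left_invariant_metric g)
  (e_basis : lie_algebra_basis3 e1 e2 e3)
  (e_orthonormal : pseudo_orthonormal3 g e1 e2 e3)
  (bracket12 : lie_bracket e1 e2
     = - e2 + smooth_cst (2 * eta - beta) *: e3)
  (bracket13 : lie_bracket e1 e3 = - (smooth_cst beta *: e2) + e3)
  (bracket23 : lie_bracket e2 e3 = smooth_cst alpha *: e1)
  (nablaL_levi_civita : is_levi_civita g nablaL)
  (J_product : is_product_structure J)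
  (J1 : J e1 = e1) (J2 : J e2 = e2) (J3 : J e3 = - e3) :
  let nablac := canonical_connection nablaL J in
  is_codazzi nablac (sym_ricci3 g nablac e1 e2 e3)
  <-> alpha / 2 + eta - beta = 0.
Proof.
have [g_tensor g_sym _] := g_lorentzian.
exact: (codazzi_G4 g_tensor g_sym
  (fun X => lie_algebra_basis3_frame X e_basis) e_orthonormal
  nablaL_levi_civita J_product J1 J2 J3 bracket12 bracket13 bracket23).
Qed.
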